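(* Let $\mathcal{U}$ be a free ultrafilter on $\omega=\{0,1,\ldots\}$. If, for every transitive group $G$ of permutations of $\omega$, $\mathcal{U}$ is $G$-selective with respect to the natural action of $G$ on $\omega$, then $\mathcal{U}$ is selective.
   Context: An ultrafilter is free if it is non-principal. A free ultrafilter $\mathcal{U}$ on an infinite set $X$ is selective if, for any partition $\mathcal{P}$ of $X$, either one cell of $\mathcal{P}$ is a member of $\mathcal{U}$, or some member of $\mathcal{U}$ meets each cell of $\mathcal{P}$ in at most one point. A group $G$ of permutations of $\omega$ is transitive if for any $x,y\in\omega$ there is $g\in G$ with $gx=y$. If a group $G$ acts transitively on an infinite set $X$, a partition $\mathcal{P}$ of $X$ is $G$-invariant if $gP\in\mathcal{P}$ for all $g\in G$ and $P\in\mathcal{P}$; a free ultrafilter $\mathcal{U}$ on $X$ is $G$-selective if, for every $G$-invariant partition $\mathcal{P}$ of $X$, either some cell of $\mathcal{P}$ is a member of $\mathcal{U}$, or there exists $U\in\mathcal{U}$ such that $|P\cap U|\leqslant 1$ for each $P\in\mathcal{P}$. *)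

(* Defs.v *)
From mathcomp Require Import all_boot all_classical.

Set Implicit Arguments.
Unset Strict Implicit.
Unset Printing Implicit Defensive.

Local Open Scope classical_set_scope.

Definition free_ultrafilter (X : Type) (U : set_system X) : Prop :=
  UltraFilter U /\ ~ exists x : X, U = principal_filter x.

(* A partition is a set of cells: pairwise disjoint, covering X, all nonempty. *)
Definition is_partition (X : Type) (P : set (set X)) : Prop :=
  classical_sets.partition P id [set: X].

Definition selective_for (X : Type) (U : set_system X) (P : set (set X)) : Prop :=
  (exists2 C, P C & U C) \/
  (exists2 A, U A & forall C, P C -> is_subset1 (C `&` A)).

Definition selective (X : Type) (U : set_system X) : Prop :=
  free_ultrafilter U /\ forall P, is_partition P -> selective_for U P.

(* The inverse of g is the only h with [cancel g h], as g is bijective. *)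
Definition permutation_group (X : Type) (G : set (X -> X)) : Prop :=
  [/\ forall g, G g -> bijective g,
      G id,
      forall g h, G g -> G h -> G (g \o h)
    & forall g h, G g -> cancel g h -> G h].

Definition transitive_group (X : Type) (G : set (X -> X)) : Prop :=
  forall x y, exists2 g, G g & g x = y.

Definition invariant_partition (X : Type) (G : set (X -> X))
    (P : set (set X)) : Prop :=
  is_partition P /\ forall g C, G g -> P C -> P (g @` C).

Definition group_selective (X : Type) (G : set (X -> X))
    (U : set_system X) : Prop :=
  free_ultrafilter U /\
  forall P, invariant_partition G P -> selective_for U P.

(* Main.v *)
Require Import Defs.
From mathcomp Require Import all_boot all_classical.

(** Any [A] in the ultrafilter with infinite complement lets a partition be
    modified off [A] so that all its cells become infinite: distribute the
    complement of [A] into infinitely many points for each cell. Selectivity for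
    the new partition gives it for the old one, as they agree on [A]. A partition
    of [nat] into infinite cells identifies [nat] with a product
    (cells) * [nat], so the group of all permutations that respect it is
    transitive. *)

Local Open Scope classical_set_scope.

Definition swap (T : eqType) (a b z : T) : T :=
  if z == a then b else if z == b then a else z.

Lemma swapK (T : eqType) (a b : T) : involutive (swap T a b).
Proof.
move=> z; rewrite /swap; case: (eqVneq z a) => [->|za].
  by case: (eqVneq b a) => [->|_] //; rewrite eqxx.
by case: (eqVneq z b) => [->|zb]; rewrite ?eqxx // (negPf za) (negPf zb).
Qed.

Lemma swapL (T : eqType) (a b : T) : swap T a b a = b.
Proof. by rewrite /swap eqxx. Qed.

Definition fibers {X T : Type} (f : X -> T) : set (set X) :=
  range (fun x => f @^-1` [set f x]).

(** An equivalence rather than an implication: a permutation of an infinite set may merge two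
    fibers, and its inverse would then split one. *)
Definition fiber_group {X T : Type} (f : X -> T) : set (X -> X) :=
  [set g | bijective g /\ forall x y, f (g x) = f (g y) <-> f x = f y].

Lemma fibers_partition {X T : Type} (f : X -> T) : is_partition (fibers f).
Proof.
split.
- rewrite eqEsubset; split=> // x _.
  by exists (f @^-1` [set f x]) => //; exists x.
- by move=> _ _ [x _ <-] [y _ <-] [z [/= zx zy]]; rewrite -zx -zy.
- by move=> _ [x _ <-]; exists x.
Qed.

Lemma fiber_group_permutation {X T : Type} (f : X -> T) :
  permutation_group (fiber_group f).
Proof.
split.
- by move=> g [].
- by split=> //; exists id.
- move=> g h [bg fg] [bh fh]; split; first exact: bij_comp.
  by move=> x y; rewrite /= fg.
- move=> g h [bg fg] gh; split; first exact: bij_can_bij gh.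
  have hg : cancel h g by apply/(bij_can_sym bg).
  by move=> x y; rewrite -{2}(hg x) -{2}(hg y) fg.
Qed.

Lemma fibers_invariant {X T : Type} (f : X -> T) :
  invariant_partition (fiber_group f) (fibers f).
Proof.
split; first exact: fibers_partition.
move=> g _ [[h gh hg] fg] [x _ <-]; exists (g x) => //.
rewrite eqEsubset; split=> y /=.
  by rewrite -{1}(hg y) => /fg fxy; exists (h y).
by move=> [z /= fzx <-]; apply/fg.
Qed.

Lemma fiber_coordinates {T : Type} (f : nat -> T) :
  (forall x, infinite_set (f @^-1` [set f x])) ->
  exists (r : nat -> nat) (s : T -> nat -> nat),
    (forall x, s (f x) (r x) = x) /\
    (forall x n, f (s (f x) n) = f x /\ r (s (f x) n) = n).
Proof.
move=> finf.
(* The nonemptiness of the fiber is assumed inside the existential, so that choice applies to every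
   label [a]; labels outside the range get the dummy [(id, id)]. *)
have coord a : exists hs : (nat -> nat) * (nat -> nat), (exists x, f x = a) ->
    (forall x, f x = a -> hs.2 (hs.1 x) = x) /\
    (forall n, f (hs.2 n) = a /\ hs.1 (hs.2 n) = n).
  have [[x <-]|] := pselect (exists x, f x = a); last first.
    by move=> nx; exists (id, id).
  have /card_set_bijP [s [sf sinj ssur]] : ([set: nat] #= f @^-1` [set f x])%card.
    by rewrite card_eq_sym; apply: eq_card_nat => //; exact: countableP.
  have sfx n : f (s n) = f x by exact: sf.
  have /choice [h hP] : forall y, exists n, f y = f x -> s n = y.
    move=> y; have [/ssur [n _ <-]|ny] := pselect (f y = f x); first by exists n.
    by exists 0.
  exists (h, s) => _; split=> [y /hP //|n]; split=> //=.
  by apply: sinj; rewrite ?inE //; exact/hP.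
have [hs hsP] := choice coord.
have fE x : exists y, f y = f x by exists x.
exists (fun x => (hs (f x)).1 x), (fun a => (hs a).2); split=> [x|x n].
  by case: (hsP _ (fE x)) => + _; exact.
by case: (hsP _ (fE x)) => _ /(_ n) [->].
Qed.

(** In the coordinates [(f, r)], exchange the labels of [x] and [y] and, independently, their
    positions. This is an involution, and its effect on labels is injective. *)
Lemma fiber_group_transitive {T : choiceType} (f : nat -> T) :
  (forall x, infinite_set (f @^-1` [set f x])) ->
  transitive_group (fiber_group f).
Proof.
move=> /fiber_coordinates [r [s [srK sP]]] x y.
pose g z := s (swap T (f x) (f y) (f z)) (swap nat (r x) (r y) (r z)).
(* [s] is controlled only at labels in the range of [f]. *)
have sw z : exists w, f w = swap T (f x) (f y) (f z).
  rewrite /swap; case: ifP => _; first by exists y.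
  by case: ifP => _; [exists x | exists z].
have fg z : f (g z) = swap T (f x) (f y) (f z).
  by rewrite /g; case: (sw z) => w <-; case: (sP w (swap nat (r x) (r y) (r z))).
have rg z : r (g z) = swap nat (r x) (r y) (r z).
  by rewrite /g; case: (sw z) => w <-; case: (sP w (swap nat (r x) (r y) (r z))).
have gK : involutive g by move=> z; rewrite {1}/g fg rg !swapK srK.
exists g; last by rewrite /g !swapL srK.
split=> [|z w]; first by exists g.
by rewrite !fg; split=> [/(inv_inj (swapK T (f x) (f y)))|->].
Qed.

(** Points of the other parity code pairs [(k, j)] and receive the label [c k], so every value of
    [c] recurs for all [j]. Non-codes keep their label, so [f] takes no value outside the range of
    [c]. *)
Lemma infinite_fibers_extension {T : Type} (c : nat -> T) (b : bool) :
  exists f : nat -> T,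
    (forall x, odd x = b -> f x = c x) /\
    (forall x, infinite_set (f @^-1` [set f x])).
Proof.
pose f x := if odd x == b then c x
  else if (unpickle x./2 : option (nat * nat)) is Some (k, _) then c k else c x.
(* The summand [~~ b] gives parity opposite to [b] and vanishes on halving. *)
pose e (k j : nat) := ~~ b + (pickle (k, j)).*2.
have fe k j : f (e k j) = c k.
  rewrite /f /e oddD odd_double addbF half_bit_double pickleK.
  by case: (b).
have fc x : exists k, f x = c k.
  rewrite /f; case: ifP => _; first by exists x.
  by case: unpickle => [[k j]|]; [exists k | exists x].
exists f; split=> [x xb|x]; first by rewrite /f xb eqxx.
have [k ->] := fc x.
apply/infiniteP/pcard_leP/injfunPex; exists (e k) => //.
  by move=> j _ /=; rewrite fe.
by move=> i j _ _ /addnI /double_inj /(pcan_inj pickleK) [].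
Qed.

Lemma partition_cell {X : Type} (P : set (set X)) : is_partition P ->
  exists c : X -> set X, [/\ forall x, P (c x), forall x, c x x
    & forall C x, P C -> C x -> C = c x].
Proof.
move=> [Pcov Ptriv _].
have /choice [c cP] : forall x, exists C, P C /\ C x.
  move=> x; have : [set: X] x by [].
  by rewrite -Pcov => -[C PC Cx]; exists C.
exists c; split=> [x|x|C x PC Cx]; try by case: (cP x).
by case: (cP x) => Pc cx; apply: Ptriv => //; exists x.
Qed.

Theorem theorem3 (U : set_system nat) (hU : free_ultrafilter U)
    (hG : forall G : set (nat -> nat),
        permutation_group G -> transitive_group G -> group_selective G U) :
  selective U.
Proof.
split=> // P Ppart.
have [c [Pc cx cE]] := partition_cell P Ppart.
have UF : UltraFilter U by case: hU.
(* The set [A] is whichever of the evens and the odds lies in [U]. *)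
have [b Ub] : exists b, U [set x | odd x = b].
  have [?|Uo] := in_ultra_setVsetC [set x | odd x = true] UF; first by exists true.
  exists false; apply: filterS Uo => x /=.
  by case: odd.
have [f [fc finf]] := infinite_fibers_extension c b.
have [_ /(_ _ (fibers_invariant f))] := hG _ (fiber_group_permutation f)
  (fiber_group_transitive f finf).
case=> [[_ [x _ <-] Ux]|[S US Ssel]].
  (* The representative [x] may have the wrong parity, where [f x] need not be its cell; [z] is a
     point of the fiber where [f] and [c] agree. *)
  have [z [/= fzx zb]] := filter_ex (filterI Ux Ub).
  left; exists (c z) => //; apply: filterS (filterI Ux Ub) => w [/= fw wb].
  by rewrite -(fc z zb) fzx -fw (fc w wb).
(* Restricted to this parity, points of one cell lie in one fiber of [f]. *)
right; exists (S `&` [set x | odd x = b]); first exact: filterI.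
move=> C PC x y [Cx [Sx /= xb]] [Cy [Sy /= yb]].
have fxy : f x = f y by rewrite !fc // -(cE C x) // -(cE C y).
by apply: (Ssel (f @^-1` [set f x])); first exists x; split=> /=.
Qed.
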